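(* Let $(V,g)$ be a Euclidean real vector space of dimension $n$ and let $h$ be a bilinear form on $V$. For $0\le q\le n$ and $0\le r\le n-q$ put $$s_{(r,q)}(h)=\frac{1}{q!\,(n-q-r)!}*\bigl(g^{n-q-r}h^q\bigr),$$ and write $s_q(h)=s_{(0,q)}(h)$. Then for any integers $r,q$ with $0\le q\le n$ and $1\le r\le n-q$: (i) the $s_{(r,q)}(h)$ are the coefficients of the polynomial $*\frac{(h-\lambda g)^{n-r}}{(n-r)!}$ in the real variable $\lambda$; precisely $$*\frac{(h-\lambda g)^{n-r}}{(n-r)!}=\sum_{q=0}^{n-r}(-1)^{n-q-r}s_{(r,q)}(h)\,\lambda^{n-q-r};$$ (ii) (general Laplace expansion) $\displaystyle\frac{(q+r)!}{q!}\,s_{q+r}(h)=\langle s_{(r,q)}(h),h^r\rangle$; (iii) (general Newton identity) $\mathrm c\bigl(s_{(r,q)}(h)\bigr)=(n-q-r+1)\,s_{(r-1,q)}(h)$.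
   Context: Let $(V,g)$ be a Euclidean real vector space of dimension $n$. A $(p,q)$ double form is an element of $\mathcal D^{p,q}=\Lambda^pV^*\otimes\Lambda^qV^*$, identified with a bilinear form $\Lambda^pV\times\Lambda^qV\to\mathbb R$. Exterior product: $(\theta_1\otimes\theta_2)(\theta_3\otimes\theta_4)=(\theta_1\wedge\theta_3)\otimes(\theta_2\wedge\theta_4)$, extended bilinearly; all products and powers in the claim are exterior products, with zeroth power $1$; bilinear forms on $V$ such as $g,h$ are regarded as $(1,1)$ double forms. Inner product: $\langle\theta_1\otimes\theta_2,\theta_3\otimes\theta_4\rangle=\langle\theta_1,\theta_3\rangle\langle\theta_2,\theta_4\rangle$, using the inner product on $\Lambda^pV^*$ for which $e^{i_1}\wedge\dots\wedge e^{i_p}$, $i_1<\dots<i_p$, are orthonormal when $(e^i)$ is dual to an orthonormal basis. Contraction $\mathrm c:\mathcal D^{p,q}\to\mathcal D^{p-1,q-1}$: $\mathrm c\,\omega(x_1\wedge\dots\wedge x_{p-1},y_1\wedge\dots\wedge y_{q-1})=\sum_{j=1}^n\omega(e_j\wedge x_1\wedge\dots\wedge x_{p-1},e_j\wedge y_1\wedge\dots\wedge y_{q-1})$ for any orthonormal basis $(e_j)$. Double Hodge star: for a $(p,p)$ double form $\omega$, $*\omega$ is the $(n-p,n-p)$ double form $*\omega(u,v)=\omega( *u,*v)$, with $*$ on the right the usual Hodge star $\Lambda^{n-p}V\to\Lambda^{p}V$ for some chosen orientation (the result does not depend on it). A $(0,0)$ double form is a scalar. *)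

(* Defs.v *)
From HB Require Import structures.
From mathcomp Require Import all_boot all_order all_algebra.
From mathcomp Require Import reals.

Set Implicit Arguments.
Unset Strict Implicit.
Unset Printing Implicit Defensive.

Import Order.TTheory GRing.Theory Num.Theory.
Local Open Scope ring_scope.

Section DoubleForms.
Variables (R : realType) (V : vectType R).

(* An element w of the direct sum of all the D^{p,q} is given by its values
   w [:: x1; ...; xp] [:: y1; ...; yq] = w(x1 /\ ... /\ xp, y1 /\ ... /\ yq);
   its (p,q) component is its restriction to pairs of sequences of sizes p, q,
   and a (p,q) double form vanishes on sequences of any other sizes.  Likewise
   an exterior form is given by its values on sequences of vectors.  A (0,0)
   double form w is the scalar w [::] [::]. *)
Definition eform := seq V -> R.
Definition dform := seq V -> seq V -> R.

(* The subfamily (xs_i) for i in I, in increasing order of i. *)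
Definition sel k (xs : seq V) (I : {set 'I_k}) : seq V :=
  [seq xs`_i | i : 'I_k in I].

(* Signature of the permutation listing I, then its complement, both in
   increasing order. *)
Definition shuffle_sign k (I : {set 'I_k}) : R :=
  (-1) ^+ #|[set ij : 'I_k * 'I_k |
             [&& ij.1 \in I, ij.2 \notin I & (ij.2 < ij.1)%N]]|.

(* Normalized so that (e^1 /\ ... /\ e^p)(e_1, ..., e_p) = 1. *)
Definition wedge (a b : eform) : eform := fun xs =>
  \sum_(I : {set 'I_(size xs)})
     shuffle_sign I * (a (sel xs I) * b (sel xs (~: I))).

Definition tens (a b : eform) : dform := fun xs ys => a xs * b ys.

(* The bilinear extension of
   (a1 (x) b1) (a2 (x) b2) = (a1 /\ a2) (x) (b1 /\ b2); see dmul_tens. *)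
Definition dmul (w1 w2 : dform) : dform := fun xs ys =>
  \sum_(I : {set 'I_(size xs)}) \sum_(J : {set 'I_(size ys)})
     shuffle_sign I * shuffle_sign J *
       (w1 (sel xs I) (sel ys J) * w2 (sel xs (~: I)) (sel ys (~: J))).

Lemma dmul_tens (a1 b1 a2 b2 : eform) :
  dmul (tens a1 b1) (tens a2 b2) =2 tens (wedge a1 a2) (wedge b1 b2).
Proof.
move=> xs ys; rewrite /dmul /tens /wedge mulr_suml; apply: eq_bigr => I _.
rewrite mulr_sumr; apply: eq_bigr => J _.
by rewrite [RHS]mulrACA; congr (_ * _); rewrite mulrACA.
Qed.

Definition dunit : dform := fun xs ys => (nilp xs && nilp ys)%:R.

Definition dexp (w : dform) (k : nat) : dform := iter k (dmul w) dunit.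

Definition dscale (a : R) (w : dform) : dform := fun xs ys => a * w xs ys.

Definition bform (b : V -> V -> R) : dform := fun xs ys =>
  match xs, ys with [:: x], [:: y] => b x y | _, _ => 0 end.

Section Euclidean.
Variables (g : {dot V for (@idfun R)}) (n : nat) (e : n.-tuple V).
(* Here e is meant to be an orthonormal basis for g. *)

(* A multivector, i.e. an element of the direct sum of the Lambda^p V, is given
   by its coordinates in the basis of the
   e_I = e_{i1} /\ ... /\ e_{ip}, I = {i1 < ... < ip}. *)
Definition multivector := {set 'I_n} -> R.

(* x1 /\ ... /\ xp: its coordinate on e_I is its inner product with e_I. *)
Definition wedge_vectors (xs : seq V) : multivector := fun I =>
  if #|I| == size xs
  then \det (\matrix_(i < size xs, j < size xs) g xs`_i (sel e I)`_j)
  else 0.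

(* Value of a double form on two multivectors, by bilinear extension. *)
Definition dapp (w : dform) (u v : multivector) : R :=
  \sum_(I : {set 'I_n}) \sum_(J : {set 'I_n})
     u I * v J * w (sel e I) (sel e J).

(* For the orientation of e: u /\ *v = <u, v> e_1 /\ ... /\ e_n, that is,
   *e_K = shuffle_sign K . e_{~: K}. *)
Definition hodge (u : multivector) : multivector := fun I =>
  shuffle_sign (~: I) * u (~: I).

Definition dstar (w : dform) : dform := fun xs ys =>
  dapp w (hodge (wedge_vectors xs)) (hodge (wedge_vectors ys)).

Definition contraction (w : dform) : dform := fun xs ys =>
  \sum_(j < n) w (tnth e j :: xs) (tnth e j :: ys).

(* The e^I (x) e^J are orthonormal, and the coordinate of w on e^I (x) e^J is
   w(e_I, e_J). *)
Definition dinner (w1 w2 : dform) : R :=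
  \sum_(I : {set 'I_n}) \sum_(J : {set 'I_n})
     w1 (sel e I) (sel e J) * w2 (sel e I) (sel e J).

Definition sform (h : V -> V -> R) (r q : nat) : dform :=
  dscale (q`!%:R * (n - q - r)`!%:R)^-1
    (dstar (dmul (dexp (bform g) (n - q - r)) (dexp (bform h) q))).

End Euclidean.
End DoubleForms.

(* Main.v *)
Require Import Defs.
From HB Require Import structures.
From mathcomp Require Import all_boot all_order all_algebra.
From mathcomp Require Import reals boolp ring zify.

Set Implicit Arguments.
Unset Strict Implicit.
Unset Printing Implicit Defensive.

Import Order.TTheory GRing.Theory Num.Theory.
Local Open Scope ring_scope.

(* The exterior product makes double forms a ring in which diagonal forms, those
   with only (p, p) components, commute.  With G(x1, ..., xp) the exterior form
   x1^b /\ ... /\ xp^b, whose values are the Gram determinants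
   det (g(x_i, u_j)), the star is a top-degree product:
     [star w] (x1, ..., xp; y1, ..., yp)
       = [(G(x1, ..., xp) (x) G(y1, ..., yp)) . w] (e, e).
   Then (i) is the binomial formula for -lambda g + h.  Since the G(e_I) are the
   dual basis, <star w, v> is the value of v . w at (e, e), which gives (ii).
   Since sum_j e_j^b (x) e_j^b = g, moving g past the Gram factor shows that
   c (star w) = star (g . w), which gives (iii). *)

(** * Subfamilies and shuffle signs when a first index is adjoined *)

Lemma sel_cons (R : realType) (V : vectType R) k x (s : seq V)
    (I : {set 'I_k.+1}) :
  sel (x :: s) I =
    (if ord0 \in I then [:: x] else [::]) ++ sel s (lift ord0 @^-1: I).
Proof.
have enumE m (J : {set 'I_m}) : enum J = [seq i <- enum 'I_m | i \in J].
  by rewrite enumT.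
rewrite /sel /image_mem !enumE enum_ordSl /=.
have -> : [seq i <- [seq lift ord0 j | j <- enum 'I_k] | i \in I]
    = map (lift ord0) [seq j <- enum 'I_k | j \in lift ord0 @^-1: I].
  by rewrite filter_map; congr map; apply: eq_filter => i /=; rewrite inE.
by case: ifP => _ /=; rewrite -map_comp.
Qed.

Lemma size_sel (R : realType) (V : vectType R) k (s : seq V) (I : {set 'I_k}) :
  size (sel s I) = #|I|.
Proof. by rewrite /sel size_map -cardE. Qed.

Lemma shuffle_signE (R : realType) k (I : {set 'I_k}) :
  shuffle_sign R I = (-1) ^+ (\sum_(i < k) \sum_(j < k)
    ([&& i \in I, j \notin I & (j < i)%N] : nat)).
Proof.
congr (_ ^+ _); rewrite pair_bigA /= -sum1_card big_mkcond /=.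
by apply: eq_bigr => ij _; rewrite inE; case: ifP.
Qed.

(** Index 0 can only be the smaller member of an inversion: outside [I] it is inverted with every
    element of [I], inside [I] with none. *)
Lemma shuffle_sign_lift (R : realType) k (I : {set 'I_k.+1}) :
  shuffle_sign R I = (if ord0 \in I then 1 else (-1) ^+ #|lift ord0 @^-1: I|)
                     * shuffle_sign R (lift ord0 @^-1: I).
Proof.
rewrite !shuffle_signE big_ord_recl /= big1 ?add0n => [|j _]; last first.
  by rewrite ltn0 !andbF.
under eq_bigr => i _.
  rewrite big_ord_recl; under [X in (_ + X)%N]eq_bigr => j _.
    rewrite -[X in X && _](@in_set _ (fun i => lift ord0 i \in I)).
    rewrite -[X in ~~ X](@in_set _ (fun i => lift ord0 i \in I)).
    by rewrite ltnS; over.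
  over.
rewrite big_split exprD; congr (_ * _).
case: ifP => I0 /=; first by rewrite big1 => // i _; rewrite andbF.
congr (_ ^+ _); rewrite -sum1_card [RHS]big_mkcond /=.
by apply: eq_bigr => i _; rewrite inE andbT; case: ifP.
Qed.

(** * Signed unshuffles of a sequence *)

Section ShuffleSum.
Variables (R : realType) (V : vectType R).
Implicit Types (F G : seq V -> seq V -> R) (s xs : seq V).

(* F applied to the signed unshuffle coproduct of xs: its laws follow by
   induction from the recursion shuffle_sum_cons, avoiding sums over subsets. *)
Definition shuffle_sum F xs : R :=
  \sum_(I : {set 'I_(size xs)})
     shuffle_sign R I * F (sel xs I) (sel xs (~: I)).

Lemma shuffle_sum_cast n F xs : size xs = n ->
  \sum_(I : {set 'I_n}) shuffle_sign R I * F (sel xs I) (sel xs (~: I))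
  = shuffle_sum F xs.
Proof. by move=> <-. Qed.

Lemma shuffle_sum_nil F : shuffle_sum F [::] = F [::] [::].
Proof.
have I0 (I : {set 'I_(size ([::] : seq V))}) : I = set0.
  by apply/setP => -[].
rewrite /shuffle_sum (big_pred1 set0) => [|I]; last exact/esym/eqP/I0.
rewrite shuffle_signE big_ord0 mul1r.
by congr F; apply: size0nil; rewrite size_sel ?[~: _]I0 cards0.
Qed.

(** The first vector joins the left block, or joins the right block after passing the [size l]
    vectors on its left, hence the sign. *)
Lemma shuffle_sum_cons F x s :
  shuffle_sum F (x :: s) =
  shuffle_sum (fun l r => F (x :: l) r + (-1) ^+ size l * F l (x :: r)) s.
Proof.
(* A subset of the indices of [x :: s] amounts to whether it contains 0, together with a subset of
   the indices of [s]. *)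
pose ext (bJ : bool * {set 'I_(size s)}) : {set 'I_(size s).+1} :=
  [set i | if unlift ord0 i is Some j then j \in bJ.2 else bJ.1].
pose res (I : {set 'I_(size s).+1}) := (ord0 \in I, lift ord0 @^-1: I).
have extK : cancel ext res.
  move=> [b J]; rewrite /res inE unlift_none; congr pair.
  by apply/setP => i; rewrite !inE liftK.
have resK : cancel res ext.
  move=> I; apply/setP => i; rewrite inE.
  by case: unliftP => [j ->|->] //; rewrite inE.
rewrite /shuffle_sum (reindex ext) /=; last by exists res => I _.
rewrite -(pair_bigA _ (fun b J => shuffle_sign R (ext (b, J)) *
  F (sel (x :: s) (ext (b, J))) (sel (x :: s) (~: ext (b, J))))) /=.
rewrite big_bool /= -big_split; apply: eq_bigr => J _ /=.
rewrite !shuffle_sign_lift !sel_cons !preimsetC.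
have [= tE tJ] : res (ext (true, J)) = (true, J) by rewrite extK.
have [= fE fJ] : res (ext (false, J)) = (false, J) by rewrite extK.
rewrite !in_setC tJ fJ.
by rewrite tE fE /= mul1r mulrDr size_sel mulrCA mulrA.
Qed.

Lemma eq_shuffle_sum F G xs :
  (forall l r, (size l + size r = size xs)%N -> F l r = G l r) ->
  shuffle_sum F xs = shuffle_sum G xs.
Proof.
move=> eqFG; apply: eq_bigr => I _; congr (_ * _); apply: eqFG.
by rewrite !size_sel cardsC card_ord.
Qed.

Lemma shuffle_sumD F G xs :
  shuffle_sum (fun l r => F l r + G l r) xs
  = shuffle_sum F xs + shuffle_sum G xs.
Proof. by rewrite -big_split; apply: eq_bigr => I _; rewrite mulrDr. Qed.

Lemma shuffle_sumZ a F xs :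
  shuffle_sum (fun l r => a * F l r) xs = a * shuffle_sum F xs.
Proof. by rewrite mulr_sumr; apply: eq_bigr => I _; rewrite mulrCA. Qed.

Lemma shuffle_sumZr a F xs :
  shuffle_sum (fun l r => F l r * a) xs = shuffle_sum F xs * a.
Proof. by rewrite mulr_suml; apply: eq_bigr => I _; rewrite mulrA. Qed.

Lemma shuffle_sum0 F xs :
  (forall l r, (size l + size r = size xs)%N -> F l r = 0) ->
  shuffle_sum F xs = 0.
Proof.
move=> F0; rewrite (@eq_shuffle_sum _ (fun _ _ => 0)) //.
by apply: big1 => I _; rewrite mulr0.
Qed.

Lemma exchange_shuffle_sum (F : seq V -> seq V -> seq V -> seq V -> R) xs ys :
  shuffle_sum (fun l r => shuffle_sum (F l r) ys) xs =
  shuffle_sum (fun l' r' => shuffle_sum (fun l r => F l r l' r') xs) ys.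
Proof.
under [LHS]eq_bigr do rewrite mulr_sumr.
under [RHS]eq_bigr do rewrite mulr_sumr.
rewrite exchange_big /=; apply: eq_bigr => J _; apply: eq_bigr => I _.
by rewrite mulrCA.
Qed.

(** Coassociativity of the coproduct: both sides distribute [xs] over three ordered blocks. *)
Lemma shuffle_sum_assoc (F : seq V -> seq V -> seq V -> R) xs :
  shuffle_sum (fun l r => shuffle_sum (fun l1 l2 => F l1 l2 r) l) xs =
  shuffle_sum (fun l r => shuffle_sum (F l) r) xs.
Proof.
elim: xs F => [|x xs IH] F; first by rewrite !shuffle_sum_nil.
rewrite !shuffle_sum_cons.
under eq_shuffle_sum => l r _.
  rewrite shuffle_sum_cons -shuffle_sumZ -shuffle_sumD.
  under eq_shuffle_sum => l1 l2 size_l.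
    rewrite -size_l exprD -mulrA -addrA -mulrDr; over.
  over.
(* The head [x] has three destinations, each with sign -1 to the number of vectors in the blocks
   before it. *)
rewrite (IH (fun l1 l2 r => F (x :: l1) l2 r + (-1) ^+ size l1 *
  (F l1 (x :: l2) r + (-1) ^+ size l2 * F l1 l2 (x :: r)))).
apply: eq_shuffle_sum => l r _.
by rewrite shuffle_sum_cons -shuffle_sumZ -shuffle_sumD.
Qed.

(** Graded cocommutativity: exchanging blocks of lengths p and q costs (-1)^(pq). *)
Lemma shuffle_sum_flip F xs :
  shuffle_sum (fun l r => (-1) ^+ (size l * size r) * F r l) xs
  = shuffle_sum F xs.
Proof.
elim: xs F => [|x xs IH] F; first by rewrite !shuffle_sum_nil mul1r.
rewrite !shuffle_sum_cons -[RHS]IH; apply: eq_shuffle_sum => l r _ /=.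
rewrite mulSn mulnS !exprD mulrDr addrC !mulrA -expr2 sqrr_sign mul1r.
by congr (_ + _ * _); rewrite mulrC.
Qed.

Lemma shuffle_sum_unitl F xs :
  shuffle_sum (fun l r => (nilp l)%:R * F l r) xs = F [::] xs.
Proof.
elim: xs F => [|x xs IH] F; first by rewrite shuffle_sum_nil mul1r.
rewrite shuffle_sum_cons -(IH (fun l r => F l (x :: r))).
apply: eq_shuffle_sum => -[|y l] r _ /=; by rewrite ?mul0r ?mulr0 ?add0r ?mul1r.
Qed.

Lemma shuffle_sum_unitr F xs :
  shuffle_sum (fun l r => (nilp r)%:R * F l r) xs = F xs [::].
Proof.
rewrite -shuffle_sum_flip -[RHS](shuffle_sum_unitl (fun l r => F r l)).
apply: eq_shuffle_sum => -[|y l] r _ /=; first by rewrite mul0n mul1r.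
by rewrite !mul0r mulr0.
Qed.

End ShuffleSum.

(** * The ring of double forms *)

Section DoubleFormRing.
Variables (R : realType) (V : vectType R).
Implicit Types u v w : dform V.

Lemma dmulE u v : dmul u v = fun xs ys =>
  shuffle_sum (fun l r => shuffle_sum (fun l' r' => u l l' * v r r') ys) xs.
Proof.
apply/funext => xs; apply/funext => ys; apply: eq_bigr => I _.
by rewrite /shuffle_sum mulr_sumr; apply: eq_bigr => J _; rewrite -mulrA.
Qed.

Definition dadd u v : dform V := fun xs ys => u xs ys + v xs ys.
Definition dopp u : dform V := fun xs ys => - u xs ys.
Definition dzero : dform V := fun _ _ => 0.

Lemma daddA : associative dadd.
Proof. by move=> u v w; do 2!apply/funext => ?; apply: addrA. Qed.
Lemma daddC : commutative dadd.
Proof. by move=> u v; do 2!apply/funext => ?; apply: addrC. Qed.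
Lemma dadd0 : left_id dzero dadd.
Proof. by move=> u; do 2!apply/funext => ?; apply: add0r. Qed.
Lemma daddN : left_inverse dzero dopp dadd.
Proof. by move=> u; do 2!apply/funext => ?; apply: addNr. Qed.

(** The algebraic structures require equality and choice, which are classical on this function
    space. *)
HB.instance Definition _ := gen_eqMixin (dform V).
HB.instance Definition _ := gen_choiceMixin (dform V).
HB.instance Definition _ :=
  GRing.isZmodule.Build (dform V) daddA daddC dadd0 daddN.

Lemma dmulA : associative (@dmul R V).
Proof.
move=> u v w; rewrite !dmulE; apply/funext => xs; apply/funext => ys.
(* In the middle term both arguments are split into three blocks nested on the right;
   coassociativity in each argument regroups them on the left. *)
transitivity (shuffle_sum (fun l r => shuffle_sum (fun r1 r2 =>
  shuffle_sum (fun l' r' => shuffle_sum (fun r1' r2' =>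
    u l l' * (v r1 r1' * w r2 r2')) r') ys) r) xs).
  apply: eq_shuffle_sum => l r _; rewrite exchange_shuffle_sum.
  apply: eq_shuffle_sum => l' r' _; rewrite -shuffle_sumZ.
  by apply: eq_shuffle_sum => r1 r2 _; rewrite shuffle_sumZ.
rewrite -(shuffle_sum_assoc (fun l r1 r2 => shuffle_sum (fun l' r' =>
  shuffle_sum (fun r1' r2' => u l l' * (v r1 r1' * w r2 r2')) r') ys)).
apply: eq_shuffle_sum => l r _.
under eq_shuffle_sum => l1 l2 _.
  rewrite -(shuffle_sum_assoc (fun l' r1' r2' =>
    u l1 l' * (v l2 r1' * w r r2'))); over.
rewrite exchange_shuffle_sum.
apply: eq_shuffle_sum => l' r' _; rewrite -shuffle_sumZr.
apply: eq_shuffle_sum => l1 l2 _; rewrite -shuffle_sumZr.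
by apply: eq_shuffle_sum => l1' l2' _; rewrite mulrA.
Qed.

Lemma d1mul : left_id (@dunit R V) (@dmul R V).
Proof.
move=> u; rewrite dmulE; apply/funext => xs; apply/funext => ys.
rewrite -[RHS](shuffle_sum_unitl (fun _ r => u r ys)).
apply: eq_shuffle_sum => l r _.
rewrite -[in RHS](shuffle_sum_unitl (fun _ r' => u r r')) -shuffle_sumZ.
by apply: eq_shuffle_sum => l' r' _; rewrite mulrA -natrM mulnb.
Qed.

Lemma dmul1 : right_id (@dunit R V) (@dmul R V).
Proof.
move=> u; rewrite dmulE; apply/funext => xs; apply/funext => ys.
rewrite -[RHS](shuffle_sum_unitr (fun l _ => u l ys)).
apply: eq_shuffle_sum => l r _.
rewrite -[in RHS](shuffle_sum_unitr (fun l' _ => u l l')) -shuffle_sumZ.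
by apply: eq_shuffle_sum => l' r' _; rewrite mulrA -natrM mulnb mulrC.
Qed.

Lemma dmulDl : left_distributive (@dmul R V) dadd.
Proof.
move=> u v w; rewrite !dmulE; apply/funext => xs; apply/funext => ys.
rewrite /dadd -shuffle_sumD; apply: eq_shuffle_sum => l r _.
by rewrite -shuffle_sumD; apply: eq_shuffle_sum => l' r' _; rewrite mulrDl.
Qed.

Lemma dmulDr : right_distributive (@dmul R V) dadd.
Proof.
move=> u v w; rewrite !dmulE; apply/funext => xs; apply/funext => ys.
rewrite /dadd -shuffle_sumD; apply: eq_shuffle_sum => l r _.
by rewrite -shuffle_sumD; apply: eq_shuffle_sum => l' r' _; rewrite mulrDr.
Qed.

HB.instance Definition _ :=
  GRing.Zmodule_isPzRing.Build (dform V) dmulA d1mul dmul1 dmulDl dmulDr.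

Lemma dexpE w k : dexp w k = w ^+ k.
Proof. by elim: k => [|k IH] //; rewrite exprS -IH. Qed.

Lemma daddE u v xs ys : (u + v) xs ys = u xs ys + v xs ys. Proof. by []. Qed.

Lemma dsumE I (s : seq I) (P : pred I) (F : I -> dform V) xs ys :
  (\sum_(i <- s | P i) F i) xs ys = \sum_(i <- s | P i) F i xs ys.
Proof. by elim/big_rec2: _ => // i a u _ <-. Qed.

Lemma dmulrnE u k xs ys : (u *+ k) xs ys = u xs ys *+ k.
Proof. by elim: k => // k IH; rewrite !mulrS daddE IH. Qed.

Lemma dscale_dmull a u v : dscale a u * v = dscale a (u * v).
Proof.
rewrite -![_ * _]/(dmul _ _) !dmulE; apply/funext => xs; apply/funext => ys.
rewrite /dscale -shuffle_sumZ; apply: eq_shuffle_sum => l r _.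
by rewrite -shuffle_sumZ; apply: eq_shuffle_sum => l' r' _; rewrite mulrA.
Qed.

Lemma dscale_dmulr a u v : u * dscale a v = dscale a (u * v).
Proof.
rewrite -![_ * _]/(dmul _ _) !dmulE; apply/funext => xs; apply/funext => ys.
rewrite /dscale -shuffle_sumZ; apply: eq_shuffle_sum => l r _.
by rewrite -shuffle_sumZ; apply: eq_shuffle_sum => l' r' _; rewrite mulrCA.
Qed.

Lemma dscaleA a b u : dscale a (dscale b u) = dscale (a * b) u.
Proof. by do 2!apply/funext => ?; rewrite /dscale mulrA. Qed.

Lemma dscale1 u : dscale 1 u = u.
Proof. by do 2!apply/funext => ?; rewrite /dscale mul1r. Qed.

Lemma dscale_exp a u k : dscale a u ^+ k = dscale (a ^+ k) (u ^+ k).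
Proof.
elim: k => [|k IH]; first by rewrite dscale1.
by rewrite !exprS IH dscale_dmull dscale_dmulr dscaleA.
Qed.

(* The (p, q) components with p <> q vanish. *)
Definition ddiag w := forall xs ys, size xs <> size ys -> w xs ys = 0.

Lemma ddiag_bform b : ddiag (bform b).
Proof. by move=> [|x [|? ?]] [|y [|? ?]]. Qed.

Lemma ddiag_mul u v : ddiag u -> ddiag v -> ddiag (u * v).
Proof.
move=> du dv xs ys neq; rewrite -[_ * _]/(dmul _ _) dmulE.
apply: shuffle_sum0 => l r slr; apply: shuffle_sum0 => l' r' slr'.
have [eql|/eqP/du ->] := eqVneq (size l) (size l'); last by rewrite mul0r.
by rewrite dv ?mulr0 // => eqr; apply: neq; rewrite -slr -slr' eql eqr.
Qed.

Lemma ddiag_exp u k : ddiag u -> ddiag (u ^+ k).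
Proof.
move=> du; elim: k => [|k IH]; last by rewrite exprS; apply: ddiag_mul.
by move=> [|x xs] [|y ys].
Qed.

(* Exchanging factors of bidegrees (p, p) and (q, q) costs (-1)^pq twice. *)
Lemma ddiag_comm u v : ddiag u -> ddiag v -> GRing.comm u v.
Proof.
move=> du dv; rewrite /GRing.comm -![_ * _]/(dmul _ _) !dmulE.
apply/funext => xs; apply/funext => ys; rewrite -[LHS]shuffle_sum_flip.
apply: eq_shuffle_sum => l r _; rewrite -shuffle_sum_flip -shuffle_sumZ.
apply: eq_shuffle_sum => l' r' _; rewrite mulrA.
have [eql|/eqP/dv ->] := eqVneq (size l) (size l'); last first.
  by rewrite mulr0 mul0r mulr0.
have [eqr|/eqP/du ->] := eqVneq (size r) (size r'); last first.
  by rewrite !mul0r !mulr0.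
by rewrite eql eqr -expr2 sqrr_sign mul1r mulrC.
Qed.

End DoubleFormRing.

(** * Gram determinants as exterior products of metric duals *)

Section Gram.
Variables (R : realType) (V : vectType R) (g : {dot V for (@idfun R)}).
Implicit Types (xs ys u : seq V).

Definition flat x : eform V := fun u => if u is [:: y] then g x y else 0.

Definition gram xs : eform V := fun u =>
  if size u == size xs
  then \det (\matrix_(i < size xs, j < size xs) g xs`_i u`_j) else 0.

(** Only unshuffles whose left block is a single [u_k] survive; moving it to the front gives (-1)^k,
    as in a cofactor expansion. *)
Lemma shuffle_sum_linear (f : V -> R) (b : seq V -> R) u :
  shuffle_sum (fun l r => (if l is [:: y] then f y else 0) * b r) u =
  \sum_(k < size u) (-1) ^+ k * (f u`_k * b (take k u ++ drop k.+1 u)).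
Proof.
elim: u b => [|y u IH] b; first by rewrite shuffle_sum_nil big_ord0 mul0r.
rewrite shuffle_sum_cons shuffle_sumD big_ord_recl /= mul1r drop0; congr (_ + _).
  rewrite -[RHS](shuffle_sum_unitl (fun _ r => f y * b r)).
  by apply: eq_shuffle_sum => -[|? ?] r _; rewrite ?mul1r ?mul0r.
under eq_bigr do rewrite /= /bump add1n exprS -mulrA.
rewrite -mulr_sumr -(IH (fun r => b (y :: r))) -shuffle_sumZ.
by apply: eq_shuffle_sum => -[|x [|? ?]] r _ //; rewrite !(mul0r, mulr0).
Qed.

(* Laplace expansion along the first row. *)
Lemma gram_cons x xs : gram (x :: xs) = wedge (flat x) (gram xs).
Proof.
apply/funext => u; rewrite [RHS](shuffle_sum_linear (g x) (gram xs)).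
have size_del k : (k < size u)%N -> size (take k u ++ drop k.+1 u) = (size u).-1.
  move=> lt_k; rewrite size_cat size_drop size_take lt_k; lia.
rewrite /gram /=; have [szu|neq] := eqVneq (size u) (size xs).+1; last first.
  (* If [u] has the wrong length, so does [u] with one entry deleted: [k] shows that [u] is
     nonempty, so the predecessor is not truncated. *)
  rewrite big1 // => k _; rewrite size_del ?ltn_ord //.
  rewrite ifN ?mulr0 //; apply: contra neq => /eqP <-.
  by rewrite prednK // (leq_trans _ (ltn_ord k)).
rewrite (expand_det_row _ ord0) szu; apply: eq_bigr => k _.
have lt_k : (k < size u)%N by rewrite szu.
rewrite size_del // szu eqxx !mxE /= mulrCA; congr (_ * _).
rewrite /cofactor /=; congr (_ * \det _); apply/matrixP => i j.
rewrite !mxE /= nth_cat size_take lt_k nth_drop; congr (g _ _).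
(* The minor skips column [k] just as the spliced list skips [u_k]: positions from [k] on shift by
   one. *)
rewrite /bump; case: (ltnP j k) => [lt_jk|le_kj].
  by rewrite nth_take // leqNgt lt_jk.
by rewrite addSn subnKC.
Qed.

Lemma gram_nil : gram [::] = fun u => (nilp u)%:R.
Proof.
by apply/funext => u; rewrite /gram det_mx00; case: eqP => [/size0nil->|]; case: u.
Qed.

Lemma tens_gram_nil : tens (gram [::]) (gram [::]) = 1.
Proof.
by do 2!apply/funext => ?; rewrite /tens gram_nil -natrM mulnb.
Qed.

Lemma ddiag_gram xs ys :
  size xs = size ys -> ddiag (tens (gram xs) (gram ys)).
Proof.
move=> eqs us vs neq; rewrite /tens /gram -eqs.
case: eqP => [eu|]; last by rewrite mul0r.
by case: eqP => [ev|]; [case: neq; rewrite eu | rewrite mulr0].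
Qed.

(** Both arguments are the same [us], so Gram factors of different degrees leave complements of
    different sizes, where [w] vanishes. *)
Lemma gram_mul_ddiag xs ys us w :
  size xs <> size ys -> ddiag w -> (tens (gram xs) (gram ys) * w) us us = 0.
Proof.
move=> neq dw; rewrite -[_ * _]/(dmul _ _) dmulE.
apply: shuffle_sum0 => l r slr; apply: shuffle_sum0 => l' r' slr'.
rewrite /tens /gram; case: eqP => [el|]; last by rewrite !mul0r.
case: eqP => [el'|]; last by rewrite mulr0 mul0r.
rewrite dw ?mulr0 // => er; apply: neq; rewrite -el -el'.
by apply: (@addIn (size r)); rewrite slr er slr'.
Qed.

End Gram.

(** * Star, inner product and contraction in an orthonormal basis *)

Section Orthonormal.
Variables (R : realType) (V : vectType R) (n : nat).
Variables (g : {dot V for (@idfun R)}) (e : n.-tuple V).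

(** After both indices are complemented, the signs in [hodge] are the shuffle signs of the product
    at [(e, e)]. *)
Lemma dstarE w xs ys :
  dstar g e w xs ys = (tens (gram g xs) (gram g ys) * w) e e.
Proof.
rewrite -[_ * _]/(dmul _ _) dmulE -(shuffle_sum_cast _ (size_tuple e)).
under eq_bigr do rewrite -(shuffle_sum_cast _ (size_tuple e)) mulr_sumr.
rewrite /dstar /dapp (reindex_inj (inv_inj (@setCK _))) /=.
apply: eq_bigr => I _; rewrite (reindex_inj (inv_inj (@setCK _))) /=.
apply: eq_bigr => J _; rewrite /hodge !setCK /tens.
have wvE zs (K : {set 'I_n}) : wedge_vectors g e zs K = gram g zs (sel e K).
  by rewrite /wedge_vectors /gram size_sel.
by rewrite !wvE mulrACA -!mulrA.
Qed.

Hypothesis e_orthonormal : orthonormal g e.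

Lemma orthonormal_nth i j :
  (i < n)%N -> (j < n)%N -> g e`_i e`_j = (i == j)%:R.
Proof.
have gC x y : g x y = g y x by rewrite hermC expr0 mul1r.
move: e_orthonormal; case: (e) => s /= /eqP <-; elim: s i j => // x s IH.
rewrite /orthonormal /= => i j /andP[/andP[/eqP gxx alls] /andP[]].
rewrite /ortho_rec /= andbT => /allP gxs ps.
have gx k : (k < size s)%N -> g x s`_k = 0.
  by move=> lt_k; apply/eqP/gxs/mem_nth.
case: i j => [|i] [|j] //= lti ltj; rewrite ?gx // 1?gC ?gx //.
by rewrite gC IH // /orthonormal alls.
Qed.

(** Equal sets give the identity matrix; for distinct sets of equal size, an index in [I] outside
    [K] gives a zero row. *)
Lemma gram_orthonormal (I K : {set 'I_n}) :
  gram g (sel e I) (sel e K) = (I == K)%:R.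
Proof.
(* Positions in [sel e J] are traced back to indices in [J], where orthonormality applies. *)
have nth_sel (J : {set 'I_n}) k : (k < #|J|)%N ->
    exists2 i : 'I_n, i \in J /\ index i (enum J) = k & (sel e J)`_k = e`_i.
  move=> ltk; have i0 := Ordinal ltk; have := enum_val i0 => j0.
  exists (nth j0 (enum J) k).
    by rewrite -mem_enum mem_nth -?cardE // index_uniq ?enum_uniq -?cardE.
  by rewrite /sel /image_mem (nth_map j0) -?cardE.
rewrite /gram !size_sel; have [<-|neIK] := eqVneq I K.
  rewrite eqxx -[RHS](det1 R #|I|); congr (\det _); apply/matrixP => i j.
  rewrite !mxE; have [a [aI ai] ->] := nth_sel I i (ltn_ord i).
  have [b [bI bj] ->] := nth_sel I j (ltn_ord j).
  rewrite orthonormal_nth // -val_eqE /= -ai -bj; congr (_%:R : R).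
  congr nat_of_bool; apply/eqP/eqP => [/val_inj->|] //.
  by move/(index_inj _ _) => ->; rewrite // mem_enum.
case: eqP => // eqc.
have /subsetPn[i iI iK] : ~~ (I \subset K).
  by apply: contra neIK => sIK; rewrite eqEcard sIK eqc leqnn.
have lti : (index i (enum I) < #|I|)%N by rewrite cardE index_mem mem_enum.
rewrite (expand_det_row _ (Ordinal lti)) big1 // => j _.
rewrite !mxE /= /sel /image_mem (nth_map i) -?cardE // nth_index ?mem_enum //.
have [b [bK _] eb] := nth_sel K j (leq_trans (ltn_ord j) (eq_leq (esym eqc))).
rewrite [X in g _ X]eb orthonormal_nth //.
by case: eqP => [/val_inj eib|]; rewrite ?mul0r //; rewrite eib bK in iK.
Qed.

(** On a basis multivector [hodge] has a single nonzero coordinate, at the complement, so each pair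
    [(I, J)] contributes one term of the shuffle expansion. *)
Lemma dinner_dstar w v : dinner e (dstar g e w) v = (v * w) e e.
Proof.
rewrite -[_ * _]/(dmul _ _) dmulE -(shuffle_sum_cast _ (size_tuple e)).
apply: eq_bigr => I _; rewrite -(shuffle_sum_cast _ (size_tuple e)) mulr_sumr.
apply: eq_bigr => J _; rewrite /dstar /dapp.
have hodgeE (K L : {set 'I_n}) :
    hodge (wedge_vectors g e (sel e K)) (~: L)
    = shuffle_sign R L * (K == L)%:R.
  by rewrite /hodge setCK -gram_orthonormal /wedge_vectors /gram !size_sel.
rewrite (bigD1 (~: I)) //= [X in _ + X]big1 ?addr0 => [|K neK]; last first.
  apply: big1 => L _; rewrite -[K]setCK hodgeE.
  case: eqP => [eK|_]; last by rewrite mulr0 !mul0r.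
  by case/eqP: neK; rewrite -[K]setCK -eK.
rewrite (bigD1 (~: J)) //= big1 ?addr0 => [|K neK]; last first.
  rewrite -[K]setCK (hodgeE J).
  case: eqP => [eK|_]; last by rewrite !(mulr0, mul0r).
  by case/eqP: neK; rewrite -[K]setCK -eK.
by rewrite !hodgeE !eqxx !mulr1 -!mulrA; congr (_ * (_ * _)); rewrite mulrC.
Qed.

Hypothesis dimV : \dim {:V} = n.

(** Parseval's identity; the dimension hypothesis makes the orthonormal family a basis. *)
Lemma orthonormal_bform :
  bform g = \sum_(j < n) tens (flat g (tnth e j)) (flat g (tnth e j)).
Proof.
apply/funext => xs; apply/funext => ys; rewrite dsumE /tens.
case: xs => [|x [|? ?]] /=; do ?by rewrite big1 // => j _; rewrite mul0r.
case: ys => [|y [|? ?]] /=; do ?by rewrite big1 // => j _; rewrite mulr0.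
have ge i j : g (tnth e i) (tnth e j) = (i == j)%:R.
  by rewrite !(tnth_nth 0) orthonormal_nth.
(* Pairing with [e_i] extracts a coefficient, which yields both freeness and the coordinates of a
   vector. *)
have gsum (c : 'I_n -> R) i : g (tnth e i) (\sum_j c j *: e`_j) = c i.
  rewrite linear_sumr (bigD1 i) //= big1 ?addr0 => [|j neji].
    by rewrite linearZ /= -tnth_nth ge eqxx mulr1.
  by rewrite linearZ /= -tnth_nth ge eq_sym (negbTE neji) mulr0.
have free_e : free e.
  by apply/freeP => c c0 i; rewrite -(gsum c) c0 linear0r.
have basis_e : basis_of {:V} e.
  by rewrite basisEfree free_e subvf size_tuple dimV /=.
have xE z : z = \sum_j coord e j z *: e`_j.
  by apply: coord_span; rewrite (span_basis basis_e) memvf.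
have gE z i : g (tnth e i) z = coord e i z by rewrite [z in LHS]xE gsum.
rewrite [y in LHS]xE linear_sumr; apply: eq_bigr => j _.
by rewrite linearZ /= -tnth_nth !gE mulrC hermC expr0 mul1r /= gE.
Qed.

Lemma contraction_dstar w : ddiag w ->
  contraction e (dstar g e w) =2 dstar g e (bform g * w).
Proof.
move=> dw xs ys; rewrite /contraction.
have dgw : ddiag (bform g * w) := ddiag_mul (@ddiag_bform _ _ g) dw.
under eq_bigr do rewrite dstarE.
(* For different lengths both sides are zero; equal lengths make the Gram factor diagonal, so that
   it commutes with [bform g]. *)
have [eqs|/eqP neqs] := eqVneq (size xs) (size ys); last first.
  rewrite dstarE gram_mul_ddiag // big1 // => j _.
  by rewrite gram_mul_ddiag //= => -[].
rewrite -(dsumE _ _ (fun j => tens (gram g (tnth e j :: xs))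
  (gram g (tnth e j :: ys)) * w)) -mulr_suml dstarE mulrA; congr ((_ * w) _ _).
rewrite -(ddiag_comm (@ddiag_bform _ _ g) (ddiag_gram g eqs)).
rewrite orthonormal_bform mulr_suml; apply: eq_bigr => j _.
by do 2!apply/funext => ?; rewrite [RHS]dmul_tens !gram_cons.
Qed.

End Orthonormal.

(** * Polynomial coefficients, Laplace expansion and Newton identity *)

Theorem theorem2p8 (R : realType) (V : vectType R) (n : nat)
    (dimV : \dim {:V} = n) (g : {dot V for (@idfun R)})
    (e : n.-tuple V) (e_orthonormal : orthonormal g e)
    (h : {bilinear V -> V -> R | *%R & *%R})
    (q r : nat) (q_le_n : (q <= n)%N) (r_bounds : (1 <= r <= n - q)%N) :
  [/\ forall lam : R,
        dstar g e (dscale (n - r)`!%:R^-1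
                     (dexp (bform (fun x y => h x y - lam * g x y)) (n - r)))
        =2 (fun xs ys => \sum_(k < (n - r).+1)
              (-1) ^+ (n - k - r) * sform g e h r k xs ys * lam ^+ (n - k - r)),
      (q + r)`!%:R / q`!%:R * sform g e h 0 (q + r) [::] [::]
        = dinner e (sform g e h r q) (dexp (bform h) r)
    & contraction e (sform g e h r q)
        =2 dscale (n - q - r + 1)%:R (sform g e h r.-1 q)].
Proof.
have fact_neq0 m : m`!%:R != 0 :> R by rewrite pnatr_eq0 -lt0n fact_gt0.
have comm_gh : GRing.comm (bform g) (bform h).
  exact: ddiag_comm (@ddiag_bform _ _ g) (@ddiag_bform _ _ h).
(* Turns the claims into identities between products of double forms. *)
have sformE p k xs ys : sform g e h p k xs ys = (k`!%:R * (n - k - p)`!%:R)^-1 *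
    (tens (gram g xs) (gram g ys) * (bform g ^+ (n - k - p) * bform h ^+ k)) e e.
  by rewrite /sform /dscale dstarE !dexpE.
split.
- move=> lam xs ys; set m := (n - r)%N.
  have -> : bform (fun x y => h x y - lam * g x y)
      = dscale (- lam) (bform g) + bform h.
    apply/funext => us; apply/funext => vs; rewrite daddE /dscale.
    case: us vs => [|u [|? ?]] [|v [|? ?]]; rewrite /= ?mulr0 ?addr0 //.
    by rewrite mulNr addrC.
  have comm_lam : GRing.comm (dscale (- lam) (bform g)) (bform h).
    by rewrite /GRing.comm dscale_dmull comm_gh dscale_dmulr.
  (* In the binomial formula for these commuting summands, [k] is the power of [h]. *)
  rewrite dstarE dscale_dmulr dexpE exprDn_comm // mulr_sumr /dscale dsumE.
  rewrite mulr_sumr; apply: eq_bigr => k _.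
  rewrite sformE subnAC -/m dscale_exp dscale_dmull mulrnAr dmulrnE.
  rewrite dscale_dmulr /dscale (exprNn lam).
  set X := (_ * _ : dform V) _ _; rewrite -mulr_natl.
  have -> : m`!%:R = 'C(m, k)%:R * (k`!%:R * (m - k)`!%:R) :> R.
    by rewrite -!natrM bin_fact // -ltnS.
  have binF : 'C(m, k)%:R != 0 :> R by rewrite pnatr_eq0 -lt0n bin_gt0 -ltnS.
  by field; rewrite !fact_neq0 binF.
- rewrite sformE tens_gram_nil mul1r /sform /dscale !dexpE.
  rewrite [RHS](_ : _ = (q`!%:R * (n - q - r)`!%:R)^-1 * dinner e
    (dstar g e (bform g ^+ (n - q - r) * bform h ^+ q))
    (bform h ^+ r)); last first.
    rewrite /dinner mulr_sumr; apply: eq_bigr => I _.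
    by rewrite mulr_sumr; apply: eq_bigr => J _; rewrite mulrA.
  rewrite dinner_dstar //.
  rewrite subn0 subnDA.
  (* The pairing puts h^r in front; moving it past the power of g gives the form defining
     s_(q+r). *)
  have -> a : bform h ^+ r * (bform g ^+ a * bform h ^+ q)
      = bform g ^+ a * bform h ^+ (q + r).
    have comm_hg : GRing.comm (bform h ^+ r) (bform g ^+ a).
      exact/commrX/commr_sym/commrX.
    by rewrite mulrA comm_hg -mulrA -exprD addnC.
  by rewrite mulrA; congr (_ * _); field; rewrite !fact_neq0.
- have [r_gt0 r_le] := andP r_bounds => xs ys.
  set w : dform V := bform g ^+ (n - q - r) * bform h ^+ q.
  have dw : ddiag w.
    by apply: ddiag_mul; apply: ddiag_exp; apply: ddiag_bform.
  have -> : contraction e (sform g e h r q) xs ys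
      = (q`!%:R * (n - q - r)`!%:R)^-1 * contraction e (dstar g e w) xs ys.
    rewrite /contraction mulr_sumr; apply: eq_bigr => j _.
    by rewrite dstarE sformE.
  rewrite contraction_dstar // /dscale sformE dstarE.
  (* Subtraction is truncated, so this needs both 1 <= r and r <= n - q. The extra power of g
     matches the one produced by contraction, and the larger factorial accounts for the factor n - q
     - r + 1. *)
  have -> : (n - q - r.-1 = (n - q - r).+1)%N by lia.
  rewrite exprS -[_ * _ * bform h ^+ q]mulrA -/w factS natrM addn1 [RHS]mulrA.
  congr (_ * _).
  by field; rewrite !fact_neq0 /= andbT -mulrS pnatr_eq0.
Qed.
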